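(* There are $2^{\mathfrak{c}}$ pairwise non-homeomorphic non-principal ultrafilters on $\omega$, viewed as subspaces of $2^\omega$.
   Context: Every subset of $\omega$ is identified with its characteristic function, so an ultrafilter on $\omega$ is regarded as a subset of the Cantor set $2^\omega$ and carries the subspace topology. $\mathfrak{c}=2^{\aleph_0}$. *)

(* Defs.v *)
From HB Require Import structures.
From mathcomp Require Import all_boot all_order all_algebra.
From mathcomp Require Import all_classical all_reals all_analysis.

Set Implicit Arguments.
Unset Strict Implicit.
Unset Printing Implicit Defensive.

Local Open Scope classical_set_scope.

Definition char_fun (A : set nat) : cantor_space := fun n => n \in A.

(* Coerced to a type, this set carries the topology induced by cantor_space:
   the library equips set_type with the initial topology of the inclusion. *)
Definition cantor_image (U : set_system nat) : set cantor_space :=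
  char_fun @` U.

Definition homeomorphic (X Y : topologicalType) : Prop :=
  exists (f : X -> Y) (g : Y -> X),
    [/\ cancel f g, cancel g f, continuous f & continuous g].

Definition nonprincipal_ultrafilter (U : set_system nat) : Prop :=
  UltraFilter U /\ ~ exists n, U = principal_filter n.

(* Main.v *)
Require Import Defs.
From mathcomp Require Import finmap.
From mathcomp Require Import all_boot all_classical all_analysis.

Local Open Scope classical_set_scope.
Local Open Scope card_scope.

(** Two counts give the result: there are at least 2^c non-principal
    ultrafilters, and each of them is homeomorphic to at most c others.

    The first count is Pospisil's theorem. The c sets [indep X] form an
    independent family modulo finite sets, so that every family [F] of subsets
    of [nat] is of the form [set X | V (indep X)] for some non-principal
    ultrafilter [V] ([exists_ultrafilter_trace_indep]).

    For the second count, a non-principal ultrafilter [U] contains all cofinite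
    sets, and countably many of these, the [tail_set]s, are already dense in
    the Cantor space. A continuous map from [U] to the Cantor space is thus
    determined by its values on them, which a single subset of [nat] records
    ([tail_code_inj]). The image of a homeomorphism, composed with the
    inclusion, gives back its target: [V] is a function of [U] and of a subset
    of [nat] ([encodes_fun]).

    It remains to see that a transversal [S] of the homeomorphism relation has
    2^c elements. By the two counts, S * 2^nat covers the set of families of
    subsets of [nat]; as 2^nat is in bijection with its square, such a family
    is the same as a map from 2^nat to P := set (set nat). So S * C covers
    C -> P, and a diagonal argument in the manner of Koenig's theorem shows that
    S has at least as many elements as P ([card_le_of_cover_power]). This
    avoids the general arithmetic of infinite cardinals. *)

(** * Cardinals and transversals *)

(** Otherwise, for each [c], the [c]-th coordinates of the functions related to
    some [r] and to [c] miss a point [h c] of [P]; then [h] is related to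
    nothing. So some [c] is such that all of [P] appears as [c]-th
    coordinates, each of them determined by an element of [A]. *)
Lemma card_le_of_cover_power {R C P : Type} {A : set R}
    (G : R -> C -> (C -> P) -> Prop) :
  (forall r c h h', A r -> G r c h -> G r c h' -> h = h') ->
  (forall h, exists r c, A r /\ G r c h) -> [set: P] #<= A.
Proof.
move=> Gfun Gcover.
have [c /choice[j jP]] :
    exists c, forall p, exists r, A r /\ exists2 h, G r c h & h c = p.
  apply: contrapT => /forallNP missed.
  have /choice[h hP] : forall c, exists p,
      forall r h, A r -> G r c h -> h c <> p.
    move=> c; have /existsNP[p pP] := missed c.
    by exists p => r h Ar Grh hp; apply: pP; exists r; split => //; exists h.
  have [r [c [Ar Grh]]] := Gcover h.
  exact: hP Ar Grh erefl.
suff /injfunPex[f] : exists2 j : P -> R, set_fun setT A j & set_inj setT j.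
  exact: inj_card_le f.
exists j => [p _|p q _ _ jpq]; first by have [] := jP p.
have [Aj [h Gh <-]] := jP p; have [_ [k Gk <-]] := jP q.
by rewrite -jpq in Gk; rewrite (Gfun _ _ _ _ Aj Gh Gk).
Qed.

Lemma exists_transversal {T : pointedType} (D : set T) (e : T -> T -> Prop) :
  (forall x, e x x) -> (forall x y, e x y -> e y x) ->
  (forall x y z, e x y -> e y z -> e x z) ->
  exists S : set T, [/\ S `<=` D, forall x, D x -> exists2 y, S y & e y x &
    forall x y, S x -> S y -> e x y -> x = y].
Proof.
move=> er es et; pose rep x := get [set y | D y /\ e y x].
have repP x : D x -> D (rep x) /\ e (rep x) x.
  by move=> Dx; apply: (@getPex _ [set y | D y /\ e y x]); exists x.
exists (rep @` D); split.
- by move=> _ [x Dx <-]; have [] := repP x Dx.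
- by move=> x Dx; exists (rep x); [exists x|have [] := repP x Dx].
(* The choice made by get depends on the class only, as an extensional set. *)
- move=> _ _ [x Dx <-] [y Dy <-] exy; congr get; apply/seteqP.
  have [_ ex] := repP x Dx; have [_ ey] := repP y Dy.
  have xy : e x y := et _ _ _ (et _ _ _ (es _ _ ex) exy) ey.
  by split=> z /= [Dz ez]; split=> //; [exact: et xy|exact: et (es _ _ xy)].
Qed.

Lemma homeomorphic_refl (X : topologicalType) : homeomorphic X X.
Proof. by exists id, id; split => // x; apply: cvg_id. Qed.

Lemma homeomorphic_sym (X Y : topologicalType) :
  homeomorphic X Y -> homeomorphic Y X.
Proof. by move=> [f [g [fK gK fc gc]]]; exists g, f. Qed.

Lemma homeomorphic_trans (X Y Z : topologicalType) :
  homeomorphic X Y -> homeomorphic Y Z -> homeomorphic X Z.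
Proof.
move=> [f [g [fK gK fc gc]]] [f' [g' [fK' gK' fc' gc']]].
exists (f' \o f), (g \o g'); split; [exact: can_comp|exact: can_comp| |] => x;
  apply: continuous_comp; by [exact: fc|exact: fc'|exact: gc|exact: gc'].
Qed.

(** * Many non-principal ultrafilters *)

Definition trace (X : set nat) (n : nat) : seq bool := mkseq (mem X) n.

Lemma trace_near_inj (X Y : set nat) :
  \forall n \near \oo, trace X n = trace Y n -> X = Y.
Proof.
have [->|XY] := pselect (X = Y); first exact: nearW.
have [k Xk] : exists k, (k \in X) != (k \in Y).
  apply: contrapT => /forallNP eqXY; apply: XY; apply/funext => k.
  by have /negP/negPn/eqP := eqXY k; rewrite -[X k]in_setE -[Y k]in_setE => ->.
near=> n => /(congr1 (nth false ^~ k)).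
have kn : (k < n)%N by near: n; exists k.+1.
by rewrite !nth_mkseq // => /eqP; rewrite (negbTE Xk).
Unshelve. all: by end_near. Qed.

(** The independent family of Fichtenholz, Kantorovich and Hausdorff: an index
    is a level [n] together with a finite set [T] of binary words, thought of
    as a clopen set of subsets of [nat]; [pickle] moves the countable set of
    indices into [nat]. *)
Definition indep (X : set nat) : set nat :=
  [set m | exists (n : nat) (T : seq (seq bool)),
     m = pickle (n, T) /\ trace X n \in T].

(** The filter generated by the [indep X] for [X] in [F], the complements of the
    others, and the sets of all indices of level at least [N]; because of the
    latter it contains all cofinite sets. A basic set of it is given by a finite
    set [Z] of sets and a bound on the level: it has the indices [(n, T)] beyond
    that bound for which [T] selects from [Z] exactly the members of [F]. *)
Definition pattern_filter (F : set (set nat)) : set_system nat :=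
  [set S | exists Z : {fset set nat}, \forall n \near \oo,
     forall T : seq (seq bool),
     (forall X, X \in Z -> (trace X n \in T) = (X \in F)) -> S (pickle (n, T))].

(** Independence of the family: at a level where the elements of [Z] have
    distinct traces, [T] can be taken to be the set of the traces of those
    elements of [Z] that belong to [F]. *)
Lemma pattern_filter_proper F : ProperFilter (pattern_filter F).
Proof.
apply: Build_ProperFilter_ex.
  move=> S [Z ZS].
  have inj : \forall n \near \oo, forall X Y, X \in Z -> Y \in Z ->
      trace X n = trace Y n -> X = Y.
    have Zinj X : X \in Z -> \forall n \near \oo, forall Y, Y \in Z ->
        trace X n = trace Y n -> X = Y.
      move=> _; apply: (@filter_bigI _ _ Z (fun Y =>
        [set n | trace X n = trace Y n -> X = Y])) => Y _.
      exact: trace_near_inj.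
    by apply: filterS (filter_bigI _ Zinj) => n nP X Y XZ; exact: nP.
  have [n [nS ninj]] := filter_ex (filterI ZS inj).
  exists (pickle (n, [seq trace X n | X <- enum_fset Z & X \in F])).
  apply: nS => X XZ; apply/mapP/idP => [[Y]|XF]; last first.
    by exists X => //; rewrite mem_filter XF.
  by rewrite mem_filter => /andP[YF YZ] /ninj ->.
split.
- by exists fset0; exact: nearW.
- move=> S S' [Z ZS] [Z' ZS']; exists (Z `|` Z')%fset.
  apply: filterS2 ZS ZS' => n nS nS' T TP.
  by split; [apply: nS|apply: nS'] => X XZ; apply: TP; rewrite inE XZ ?orbT.
- move=> S S' SS' [Z ZS]; exists Z; apply: filterS ZS => n nS T /nS.
  exact: SS'.
Qed.

(** Any ultrafilter above [pattern_filter F] has this property. *)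
Lemma exists_ultrafilter_trace_indep F : exists V,
  nonprincipal_ultrafilter V /\ [set X | V (indep X)] = F.
Proof.
have [V [VU FV]] := ultraFilterLemma (pattern_filter_proper F).
have VI X : F X -> V (indep X).
  move=> FX; apply: FV; exists [fset X]%fset; apply: nearW => n T /(_ X).
  rewrite inE eqxx => /(_ isT) TX; exists n, T.
  by rewrite TX; split=> //; exact: mem_set.
have VC X : ~ F X -> V (~` indep X).
  move=> FX; apply: FV; exists [fset X]%fset; apply: nearW => n T /(_ X).
  rewrite inE eqxx memNset // => /(_ isT) TX.
  by move=> [n' [T' [/(pcan_inj pickleK)[<- <-]]]]; rewrite TX.
exists V; split; first split=> // -[m Vm].
(* The filter contains the complement of {m}: indices of level beyond that of
   m are different from m. *)
- have : V (~` [set m]); last by rewrite Vm => /principal_filterP; apply.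
  apply: FV; exists fset0.
  have : \forall n \near \oo, (forall n' (T : seq (seq bool)),
      m = pickle (n', T) -> n' < n)%N.
    have [[[n0 T0] ->]|no] :=
      pselect (exists z : nat * seq (seq bool), m = pickle z).
      by exists n0.+1 => // n /= n0n n' T' /(pcan_inj pickleK)[<- _].
    by apply: nearW => n n' T' mE; case: no; exists (n', T').
  by apply: filterS => n nP T _ /= /esym/nP; rewrite ltnn.
- apply/seteqP; split=> X /= => [VX|]; last exact: VI.
  apply: contrapT => /VC VnX.
  by have [x []] := filter_ex (filterI VX VnX).
Qed.

(** * Homeomorphic copies of an ultrafilter *)

(* The default value true of nth makes these sets cofinite. *)
Definition tail_set (s : seq bool) : set nat := [set k | nth true s k].

Lemma nonprincipal_tail {U} s : nonprincipal_ultrafilter U -> U (tail_set s).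
Proof.
move=> [UU npU].
have co n : U (~` [set n]).
  have [Un|//] := in_ultra_setVsetC [set n] UU; case: npU; exists n.
  apply: (@max_filter _ _ (principal_filter_ultra n)) => A nA.
  exact: filterS Un.
have ge n : U [set k | n <= k]%N.
  elim: n => [|n IH]; first by apply: filterS filterT.
  apply: filterS (filterI IH (co n)) => k [/= nk kn].
  by rewrite ltn_neqAle nk andbT; apply/eqP => nE; apply: kn.
by apply: filterS (ge (size s)) => k /= sk; rewrite /tail_set /= nth_default.
Qed.

(** The initial segments of [x], prolonged by ones, converge to [x]. *)
Lemma tail_sets_dense {U} (x : cantor_image U) :
  nonprincipal_ultrafilter U ->
  exists2 y : nat -> cantor_image U,
    (forall n, exists s, val (y n) = char_fun (tail_set s)) & y @ \oo --> x.
Proof.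
move=> npU.
have yP n : char_fun (tail_set (mkseq (val x) n)) \in cantor_image U.
  apply/mem_set; exists (tail_set (mkseq (val x) n)) => //.
  exact: nonprincipal_tail.
pose y n : cantor_image U := SigSub (yP n).
exists y => [n|]; first by exists (mkseq (val x) n).
move=> W [_ [[B oB <-] Bx]] BW.
have vy : (fun n => val (y n) : cantor_space) @ \oo --> (val x : cantor_space).
  apply/cvg_sup => k A [_ [[D _ <-] Dx]] DA.
  exists k.+1 => // n /= kn; apply: DA.
  rewrite /= /char_fun.
  suff -> : (k \in tail_set (mkseq (val x) n)) = val x k by [].
  by apply/idP/idP; rewrite in_setE /tail_set /= nth_mkseq.
by apply: filterS BW _; apply: vy; exact: open_nbhs_nbhs.
Qed.

(** The restriction of [f] to the countably many [tail_set]s that lie in [U],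
    as a set of naturals. Ranging over all points [x] above a [tail_set] keeps
    the definition meaningful for every [U]. *)
Definition tail_code {U} (f : cantor_image U -> cantor_space) : set nat :=
  [set m | exists (s : seq bool) (k : nat) x,
     [/\ m = pickle (s, k), val x = char_fun (tail_set s) & f x k]].

Lemma tail_code_sub {U} (f f' : cantor_image U -> cantor_space) x s k :
  val x = char_fun (tail_set s) -> tail_code f `<=` tail_code f' ->
  f x k -> f' x k.
Proof.
move=> xs ff' fxk.
have /ff'[_ [_ [x' [/(pcan_inj pickleK)[<- <-] x's f'x'k]]]] :
  tail_code f (pickle (s, k)) by exists s, k, x.
by rewrite (_ : x = x') //; apply: val_inj; rewrite xs x's.
Qed.

(** Continuous maps that agree on a dense set are equal. *)
Lemma tail_code_inj {U} (f f' : cantor_image U -> cantor_space) :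
  nonprincipal_ultrafilter U -> continuous f -> continuous f' ->
  tail_code f = tail_code f' -> f = f'.
Proof.
move=> npU fc f'c ff'; apply/funext => x.
have [y y_tail yx] := tail_sets_dense x npU.
have fy : f \o y = f' \o y.
  apply/funext => n; apply/funext => k /=; have [s ys] := y_tail n.
  by apply/idP/idP; apply: tail_code_sub ys _; rewrite ff'.
apply: (cvg_unique cantor_space_hausdorff (F := f \o y @ \oo)).
  exact: cvg_comp yx (fc x).
by rewrite fy; exact: cvg_comp yx (f'c x).
Qed.

Lemma char_fun_inj : injective char_fun.
Proof.
move=> A B AB; apply/funext => k.
by rewrite -[A k]in_setE -[B k]in_setE -[k \in A]/(char_fun A k) AB.
Qed.

(** A relation rather than a decoding function, since most sets [c] are not the
    code of a continuous map. *)
Definition encodes (U : set_system nat) (c : set nat) (V : set_system nat) :=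
  exists f : cantor_image U -> cantor_space,
    [/\ continuous f, range f = cantor_image V & tail_code f = c].

Lemma encodes_fun U c V V' : nonprincipal_ultrafilter U ->
  encodes U c V -> encodes U c V' -> V = V'.
Proof.
move=> npU [f [fc fV <-]] [f' [f'c f'V' /esym/(tail_code_inj _ _ npU fc f'c)]].
move=> ff'.
have VV' : cantor_image V = cantor_image V' by rewrite -fV -f'V' ff'.
apply/funext => A; rewrite -[V A](image_inj char_fun_inj).
by rewrite -[V' A](image_inj char_fun_inj) -!/(cantor_image _) VV'.
Qed.

Lemma homeomorphic_encodes U V :
  homeomorphic (cantor_image U) (cantor_image V) -> exists c, encodes U c V.
Proof.
move=> [f [g [_ gK fc _]]]; exists (tail_code (val \o f)), (val \o f).
split => //.
- move=> x; apply: continuous_comp; [exact: fc|exact: initial_continuous].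
- apply/seteqP; split=> [_ [x _ <-]|z Vz]; first exact/set_mem/(valP (f x)).
  by exists (g (SigSub (mem_set Vz))); rewrite //= gK.
Qed.

(** * The number of homeomorphism types *)

Definition interleave (A B : set nat) : set nat :=
  [set n | if odd n then A n./2 else B n./2].

Lemma interleave_inj A B A' B' :
  interleave A B = interleave A' B' -> A = A' /\ B = B'.
Proof.
move=> eqI; split; apply/funext => n.
  have := congr1 (fun X : set nat => X n.*2.+1) eqI.
  by rewrite /interleave /mkset /= odd_double /= uphalf_double.
have := congr1 (fun X : set nat => X n.*2) eqI.
by rewrite /interleave /mkset /= odd_double doubleK.
Qed.

(* [set: set (set nat)] has cardinality 2^c, as c is that of set nat. *)
Theorem corollary2 :
  exists S : set (set_system nat),
    [/\ S #= [set: set (set nat)],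
        forall U, S U -> nonprincipal_ultrafilter U &
        forall U V, S U -> S V -> U <> V ->
          ~ homeomorphic (cantor_image U) (cantor_image V)].
Proof.
have [|U V|U V W|S [Snp Scover Sinj]] := exists_transversal
  nonprincipal_ultrafilter
  (fun U V => homeomorphic (cantor_image U) (cantor_image V)).
- by move=> U; exact: homeomorphic_refl.
- exact: homeomorphic_sym.
- exact: homeomorphic_trans.
exists S; split=> [|//|U V SU SV UV hUV]; last exact/UV/Sinj.
apply/card_eqPle; split; first exact: card_leT.
(* Every map from set nat to set (set nat) is decode V for some V, as
   interleave is injective; and V is given by an element of S and a code. *)
pose decode V (A : set nat) : set (set nat) :=
  [set B | V (indep (interleave A B))].
apply: (card_le_of_cover_power
  (fun U c h => exists2 V, encodes U c V & h = decode V)).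
  move=> U c h h' /Snp npU [V UV ->] [V' UV' ->].
  by rewrite (encodes_fun U c V V').
move=> h.
have [V [npV Vh]] := exists_ultrafilter_trace_indep
  [set X | exists A B, X = interleave A B /\ h A B].
have [U SU /homeomorphic_encodes[c UV]] := Scover V npV.
exists U, c; split => //; exists V => //.
apply/funext => A; apply/seteqP.
rewrite /decode; split=> B /=; rewrite -[V _]/([set X | V (indep X)] _) Vh.
  by move=> hAB; exists A, B.
by move=> [A' [B' [/interleave_inj[-> ->]]]].
Qed.
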